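(* Let $f_1,\dots,f_n\in\mathbf R[x]$, $x=(x_1,\dots,x_n)$, and $\delta_f=\sum_{i=1}^n(\deg(f_i)-1)$. Let $E$ be a functional on $\mathbf R[x]$ that annuls $(f)_x$ and satisfies $E*1-1\in(f)_x$. Then: 1) If $F\in\mathbf R[x^{\le d}]$, then $E*F\in\mathbf R[x^{\le\delta_f}]$ and $F-E*F\in(f)_x\cap\mathbf R[x^{\le\max(\delta_f,d)}]$. 2) If a functional $l$ annuls $(f)_x$, then $l=E*l=l*E=E\cdot\bigl(l(y_* ).\det\|\nabla f(x,y)\|\bigr)$. 3) If a functional $l$ annuls $(f)_x$ and $L'$ is a functional with $L'=l$ in $\mathbf R[x^{\le\delta_f+\delta}]$, where $\delta\ge0$, then $l=E*L'=L'*E$. 4) If a functional $L$ annuls $(f)_x\cap\mathbf R[x^{\le\delta_f+\delta}]$, where $\delta\ge0$, then $L=E*L=L*E$ in $\mathbf R[x^{\le\delta_f+\delta}]$; moreover $E*L=L*E$ annuls $(f)_x$. 5) If a functional $l$ annuls $(f)_x$ and $\delta\ge0$, then $l$ is uniquely determined by its action on $\mathbf R[x^{\le\delta_f+\delta}]$ (that is, any two functionals annulling $(f)_x$ that agree on $\mathbf R[x^{\le\delta_f+\delta}]$ are equal).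
   Context: $\mathbf R$ is a commutative ring with unity, $x=(x_1,\dots,x_n)$ are variables and $y=(y_1,\dots,y_n)$ is a second copy of them. $\deg$ is total degree; the $f_i$ are nonzero so that $\deg f_i$ is an integer. $\mathbf R[x^{\le d}]$ is the set of polynomials in $\mathbf R[x]$ of total degree $\le d$ (it is $\{0\}$ if $d<0$). $(f)_x$ is the ideal of $\mathbf R[x]$ generated by $f_1,\dots,f_n$. A functional is an $\mathbf R$-linear map $L:\mathbf R[x]\to\mathbf R$, with value on $F$ written $L.F$. It annuls a set $S$ if $L.s=0$ for all $s\in S$. Two functionals are equal in a subspace $V$ if they agree on all elements of $V$. For a functional $L$ and $G\in\mathbf R[x]$, the functional $L\cdot G$ is defined by $(L\cdot G).F=L.(GF)$. $L(y_* )$ denotes the functional $L$ acting on the variables $y$; it is applied to a polynomial in $(x,y)$ by $\mathbf R[x]$-linear extension and gives an element of $\mathbf R[x]$. Difference derivatives: $\nabla F(x,y)$ is a column $(\nabla^1F,\dots,\nabla^nF)^T$ of polynomials in $\mathbf R[x,y]$ of total degree $\le\deg F-1$ in $(x,y)$ (zero if $F$ is constant) with $F(x)-F(y)=\sum_k(x_k-y_k)\nabla^kF(x,y)$. Fix any choice of $\nabla f_i$ for each $i$, and let $\nabla f(x,y)$ be the $n\times n$ matrix with columns $\nabla f_1,\dots,\nabla f_n$; $\det\|\nabla f(x,y)\|$ is its determinant. Also fix an $\mathbf R$-linear operator $\nabla_x(x,y):F\mapsto\nabla F(x,y)$ giving such columns for all $F\in\mathbf R[x]$. Extension operation: for a functional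 $L$ and $F\in\mathbf R[x]$, $$L*F=[L].F=L(y_* ).\det\begin{pmatrix}\nabla f(x,y)&\nabla F(x,y)\\ f(x)&F(x)\end{pmatrix}=L(y_* ).\det\begin{pmatrix}\nabla f(x,y)&\nabla F(x,y)\\ f(y)&F(y)\end{pmatrix}\in\mathbf R[x],$$ where $f(x)$ is the row $(f_1(x),\dots,f_n(x))$; thus $[L]$ is an $\mathbf R$-linear operator on $\mathbf R[x]$. For functionals $l,L$, the functional $l*L$ is defined by $(l*L).F=l.(L*F)$. All degree bounds $d,\delta$ are integers. *)

(* Defs.v *)
From HB Require Import structures.
From mathcomp Require Export all_boot all_order all_algebra.
From mathcomp Require Export ssrcomplements mpoly.

Set Implicit Arguments.
Unset Strict Implicit.
Unset Printing Implicit Defensive.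

Import GRing.Theory Num.Theory.
Local Open Scope ring_scope.

Lemma det_border (S : comNzRingType) n (A : 'M[S]_n) (r : 'rV_n)
    (u v : 'cV_n) (c a b : S) :
  \det (block_mx A (c *: u + v) r (c * a + b)%:M) =
  c * \det (block_mx A u r a%:M) + \det (block_mx A v r b%:M).
Proof.
rewrite -[LHS]det_tr -[X in _ = c * X + _]det_tr -[X in _ = _ + X]det_tr.
rewrite !tr_block_mx -[X in _ = _ + X]mul1r !tr_scalar_mx.
have row'E (B : 'M[S]_(n, n + 1)) (w w' : 'rV[S]_(n + 1)) :
    row' (rshift n ord0) (col_mx B w) = row' (rshift n ord0) (col_mx B w').
  apply/matrixP=> i j; rewrite mxE [RHS]mxE.
  case: (split_ordP (lift (rshift n ord0) i)) => k E; rewrite E.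
    by rewrite !col_mxEu.
  by have := neq_lift (rshift n ord0) i; rewrite E (ord1 k) eqxx.
rewrite /block_mx; apply: (determinant_multilinear (i0 := rshift n ord0));
  [|exact: row'E|exact: row'E].
rewrite !rowKd !row_row_mx !scale_row_mx add_row_mx !scale1r.
by congr row_mx; apply/rowP => j; rewrite !mxE ?mulrnDl ?mulrnAr.
Qed.

Section Definitions.
Context {n : nat} {R : comNzRingType}.

Implicit Types (F G p : {mpoly R[n]}) (P : {mpoly {mpoly R[n]}[n]}).

(* Total degree as an integer; the value on the zero polynomial is -1. *)
Definition tdeg p : int := (msize p)%:Z - 1.

(* Membership in R[x^{<= d}]; for d < 0 only the zero polynomial qualifies. *)
Definition deg_le (d : int) p : Prop :=
  forall m, m \in msupp p -> (mdeg m)%:Z <= d.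

Definition delta (f : 'I_n -> {mpoly R[n]}) : int :=
  \sum_(i < n) (tdeg (f i) - 1).

Definition in_ideal (f : 'I_n -> {mpoly R[n]}) p : Prop :=
  exists g : 'I_n -> {mpoly R[n]}, p = \sum_(i < n) g i * f i.

Definition annuls (L : {mpoly R[n]} -> R) (S : {mpoly R[n]} -> Prop) : Prop :=
  forall p, S p -> L p = 0.

Definition eq_on (V : {mpoly R[n]} -> Prop) (L L' : {mpoly R[n]} -> R) : Prop :=
  forall p, V p -> L p = L' p.

(* R[x,y] is encoded as R[x][y]: the outer variables are the y_k and the
   coefficients are polynomials in the x_k. *)
Definition atx F : {mpoly {mpoly R[n]}[n]} := F%:MP_[n].
Definition aty F : {mpoly {mpoly R[n]}[n]} := map_mpoly (@mpolyC n R) F.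

(* Bound on the total degree in (x, y). *)
Definition deg2_le (d : int) P : Prop :=
  forall m m', m' \in msupp P@_m -> (mdeg m + mdeg m')%N%:Z <= d.

(* When F is constant the bound is negative, so D = 0. *)
Definition diff_derivative F (D : 'cV[{mpoly {mpoly R[n]}[n]}]_n) : Prop :=
  (forall k, deg2_le (tdeg F - 1) (D k 0)) /\
  atx F - aty F = \sum_(k < n) (atx 'X_k - aty 'X_k) * D k 0.

(* L acting on the variables y, extended R[x]-linearly. *)
Definition yapp (L : {mpoly R[n]} -> R) P : {mpoly R[n]} :=
  \sum_(m <- msupp P) L 'X_[m] *: P@_m.

Definition dotf (L : {scalar {mpoly R[n]}}) G F : R := L (G * F).

Lemma dotf_scalar L G : scalar (dotf L G).
Proof. by move=> c F F'; rewrite /dotf mulrDr -scalerAr linearP. Qed.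

HB.instance Definition _ L G :=
  GRing.isLinear.Build R {mpoly R[n]} R *%R (dotf L G) (dotf_scalar L G).

Lemma yapp_scalar (L : {mpoly R[n]} -> R) : scalar (yapp L).
Proof.
have yappE k P : (msize P <= k)%N ->
    yapp L P = \sum_(m : 'X_{1..n < k}) L 'X_[m] *: P@_m.
  move=> le_Pk; rewrite /yapp (big_mksub 'X_{1..n < k}) //=; first last.
    by move=> x /msize_mdeg_lt /leq_trans/(_ le_Pk) ->.
    exact: msupp_uniq.
  rewrite big_rmcond //= => m.
  by move/memN_msupp_eq0 ->; rewrite scaler0.
move=> c P Q.
pose k := maxn (msize (c *: P + Q)) (maxn (msize P) (msize Q)).
rewrite !(yappE k) ?leq_max ?leqnn ?orbT //.
rewrite mulr_sumr -big_split /=; apply: eq_bigr => m _.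
by rewrite mcoeffD mcoeffZ scalerDr scalerAr.
Qed.

HB.instance Definition _ L :=
  GRing.isLinear.Build {mpoly R[n]} {mpoly {mpoly R[n]}[n]} {mpoly R[n]} *%R
    (yapp L) (yapp_scalar L).

Section Extension.
Variables (f : 'I_n -> {mpoly R[n]}).
(* Column i of N is the chosen difference derivative of f i; it need not be
   the value at f i of the operator D. *)
Variable N : 'M[{mpoly {mpoly R[n]}[n]}]_n.
(* D is R-linear: a scalar c : R acts on columns over R[x,y] through the
   constant polynomial c. *)
Variable D : {linear {mpoly R[n]} -> 'cV[{mpoly {mpoly R[n]}[n]}]_n |
  (@mpolyC n {mpoly R[n]} \o @mpolyC n R) \; *:%R}.

Definition ext_det F : {mpoly {mpoly R[n]}[n]} :=
  \det (block_mx N (D F) (\row_i atx (f i)) (atx F)%:M : 'M_(n + 1)).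

Definition ext (L : {mpoly R[n]} -> R) F : {mpoly R[n]} := yapp L (ext_det F).

Definition extf (l L : {mpoly R[n]} -> R) F : R := l (ext L F).

Lemma ext_det_linear c F G :
  ext_det (c *: F + G) = c%:MP%:MP * ext_det F + ext_det G.
Proof.
rewrite /ext_det linearP -det_border; congr (\det (block_mx _ _ _ _%:M)).
by rewrite /atx raddfD /= -mul_mpolyC rmorphM.
Qed.

Lemma ext_linear (L : {scalar {mpoly R[n]}}) : linear (ext L).
Proof.
move=> c F G; rewrite /ext ext_det_linear mul_mpolyC linearP /=.
by rewrite mul_mpolyC.
Qed.

HB.instance Definition _ (L : {scalar {mpoly R[n]}}) :=
  GRing.isLinear.Build R {mpoly R[n]} {mpoly R[n]} *:%R
    (ext L) (ext_linear L).

Lemma extf_scalar (l L : {scalar {mpoly R[n]}}) : scalar (extf l L).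
Proof. by move=> c F G; rewrite /extf !linearP. Qed.

HB.instance Definition _ (l L : {scalar {mpoly R[n]}}) :=
  GRing.isLinear.Build R {mpoly R[n]} R *%R (extf l L) (extf_scalar l L).

(* The last row may be evaluated at y instead of x. *)
Lemma ext_det_aty F :
  (forall i, diff_derivative (f i) (col i N)) -> diff_derivative F (D F) ->
  ext_det F =
  \det (block_mx N (D F) (\row_i aty (f i)) (aty F)%:M : 'M_(n + 1)).
Proof.
move=> dN [_ dF].
pose u : 'rV[{mpoly {mpoly R[n]}[n]}]_n := \row_k (atx 'X_k - aty 'X_k).
have -> : block_mx N (D F) (\row_i aty (f i)) (aty F)%:M =
  block_mx 1%:M 0 (- u) 1%:M *m
  block_mx N (D F) (\row_i atx (f i)) (atx F)%:M.
  rewrite mulmx_block !mul1mx !mul0mx !addr0; congr block_mx.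
    apply/rowP=> i; have [_ di] := dN i; rewrite !mxE.
    under eq_bigr do rewrite !mxE mulNr.
    rewrite sumrN.
    suff -> : \sum_k (atx 'X_k - aty 'X_k) * N k i = atx (f i) - aty (f i).
      by rewrite opprB subrK.
    by rewrite di; apply: eq_bigr => k _; rewrite mxE.
  apply/matrixP=> i j; rewrite !ord1 !mxE /= !mulr1n.
  under eq_bigr do rewrite !mxE mulNr.
  by rewrite sumrN -dF opprB subrK.
by rewrite det_mulmx det_lblock !det1 !mul1r.
Qed.

End Extension.
End Definitions.

(* Main.v *)
Require Import Defs.
From mathcomp Require Import perm.
Import Order.TTheory GRing.Theory Num.Theory.
Local Open Scope ring_scope.

(** Let [A] be the quotient of [R[x]] by the ideal [(f)] and [Delta] the
    determinant of the matrix [N(x,y)] of difference derivatives.  Expanding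
    the bordered determinant along its last row, in either of its two forms,
    gives everything the proof needs to know about the extension operation:

    - with last row at [x], [L * F] is congruent to [F * L(y).Delta] modulo
      [(f)], for every functional [L] ([ext_mod_ideal]);
    - with last row at [y], [l * F = (l . F)(y).Delta] exactly, when [l]
      annuls [(f)] ([ext_annuls]).

    The first identity and [E * 1 = 1] modulo [(f)] show that [E * F]
    represents the class of [F] ([ext_retract]).  The second bounds its degree,
    because [Delta] has total degree at most [delta f] in [(x,y)].  Hence
    a functional annulling [(f)] is determined by its values in degree at most
    [delta f], and [l = l * E].

    The heart of the matter is [l = E . (l(y).Delta)]: the functional [E]
    generates the [A]-module dual to [A].  Exchanging the order of application
    in [l.F = l.(E * F) = l(x) E(y) F(y) Delta(x,y)] yields [l = E . w] with
    [w = l(x).Delta(x,y)], a polynomial in [y].  Then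
    [l(y).Delta = E(y).(w(y) Delta) = E * w], which is congruent to [w]; so [w]
    may be replaced by [l(y).Delta] ([functional_eq_dotf]).

    For a functional known only in bounded degree, [E * L'] and [L' * E]
    involve only the values of [L'] in degree at most [delta f], so they agree
    with those of any [l] that annuls [(f)] and coincides with [L'] there.
    When [L] annuls only the part of [(f)] of bounded degree, [L * E] is such
    an [l]. *)

(** * Degree bounds *)

Section Degree.
Set Implicit Arguments.
Unset Strict Implicit.
Context {n : nat} {R : comNzRingType}.
Implicit Types (p q F G : {mpoly R[n]}) (P Q : {mpoly {mpoly R[n]}[n]}).

Lemma deg_leP d p :
  deg_le d p <-> (forall m, d < (mdeg m)%:Z -> p@_m = 0).
Proof.
split=> [dp m lt_dm | dp m]; last first.
  by rewrite mcoeff_msupp => nz; rewrite leNgt; apply: contraNN nz => /dp ->.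
by apply: memN_msupp_eq0; apply: contraL lt_dm => /dp; rewrite -leNgt.
Qed.

Lemma deg_le_trans d d' p : d <= d' -> deg_le d p -> deg_le d' p.
Proof. by move=> le_dd' dp m /dp /le_trans; apply. Qed.

Lemma deg_leD d p q : deg_le d p -> deg_le d q -> deg_le d (p + q).
Proof.
move=> /deg_leP dp /deg_leP dq; apply/deg_leP => m lt_dm.
by rewrite mcoeffD dp ?dq ?addr0.
Qed.

Lemma deg_leN d p : deg_le d p -> deg_le d (- p).
Proof.
by move=> /deg_leP dp; apply/deg_leP => m lt_dm; rewrite mcoeffN dp ?oppr0.
Qed.

Lemma deg_leZ d c p : deg_le d p -> deg_le d (c *: p).
Proof.
by move=> /deg_leP dp; apply/deg_leP => m lt_dm; rewrite mcoeffZ dp ?mulr0.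
Qed.

Lemma deg_le0 d : deg_le d (0 : {mpoly R[n]}).
Proof. by apply/deg_leP => m _; rewrite mcoeff0. Qed.

Lemma deg_le_sum (I : Type) (r : seq I) (P : pred I) (F : I -> {mpoly R[n]}) d :
  (forall i, P i -> deg_le d (F i)) -> deg_le d (\sum_(i <- r | P i) F i).
Proof.
move=> dF; apply: big_ind => // [|p q dp dq]; first exact: deg_le0.
exact: deg_leD.
Qed.

Lemma deg_leM d d' p q : deg_le d p -> deg_le d' q -> deg_le (d + d') (p * q).
Proof.
move=> dp dq m /msuppM_le /allpairsP[[m1 m2] /= [/dp le1 /dq le2 ->]].
by rewrite mdegD PoszD lerD.
Qed.

Lemma deg2_leP d P :
  deg2_le d P <-> (forall m, deg_le (d - (mdeg m)%:Z) P@_m).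
Proof.
split=> dP m m' => [/dP | /(dP m)].
  by rewrite lerBrDr PoszD addrC.
by rewrite lerBrDr PoszD addrC.
Qed.

Lemma deg2_le0 d : deg2_le d (0 : {mpoly {mpoly R[n]}[n]}).
Proof. by apply/deg2_leP => m; rewrite mcoeff0; apply: deg_le0. Qed.

Lemma deg2_leD d P Q : deg2_le d P -> deg2_le d Q -> deg2_le d (P + Q).
Proof.
move=> /deg2_leP dP /deg2_leP dQ; apply/deg2_leP => m.
by rewrite mcoeffD; apply: deg_leD.
Qed.

Lemma deg2_leN d P : deg2_le d P -> deg2_le d (- P).
Proof.
by move=> /deg2_leP dP; apply/deg2_leP => m; rewrite mcoeffN; apply: deg_leN.
Qed.

Lemma deg2_le1 : deg2_le 0 (1 : {mpoly {mpoly R[n]}[n]}).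
Proof.
move=> m m'; rewrite mcoeff1; have [->|_] := eqVneq; last by rewrite msupp0.
by rewrite msupp1 inE => /eqP ->; rewrite mdeg0.
Qed.

Lemma deg2_leM d d' P Q :
  deg2_le d P -> deg2_le d' Q -> deg2_le (d + d') (P * Q).
Proof.
move=> /deg2_leP dP /deg2_leP dQ; apply/deg2_leP => m.
rewrite mcoeffM; apply: deg_le_sum => k /eqP mE.
suff dk m1 m2 : deg_le (d + d' - (mdeg (m1 + m2))%:Z) (P@_m1 * Q@_m2).
  by have := dk k.1 k.2; rewrite -mE.
by rewrite mdegD PoszD opprD addrACA; apply: deg_leM.
Qed.

(** Each term of the determinant takes one factor from each column, so only
    column-wise bounds matter. *)
Lemma deg2_le_det k (A : 'M[{mpoly {mpoly R[n]}[n]}]_k) (d : 'I_k -> int) :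
  (forall i j, deg2_le (d j) (A i j)) -> deg2_le (\sum_j d j) (\det A).
Proof.
move=> dA; rewrite /determinant; apply: big_ind => [||s _].
- exact: deg2_le0.
- by move=> *; apply: deg2_leD.
rewrite mulr_sign (reindex_inj (@perm_inj _ s)) /=.
have dprod : deg2_le (\sum_j d (s j)) (\prod_i A i (s i)).
  apply: (big_ind2 (fun e P => deg2_le e P)) => //; first exact: deg2_le1.
  by move=> *; apply: deg2_leM.
by case: ifP => // _; apply: deg2_leN.
Qed.

Lemma deg_le_yapp (L : {mpoly R[n]} -> R) d P :
  deg2_le d P -> deg_le d (yapp L P).
Proof.
move=> /deg2_leP dP; apply: deg_le_sum => m _; apply: deg_leZ.
by apply: deg_le_trans (dP m); rewrite lerBlDr lerDl.
Qed.

Lemma eq_yapp (L L' : {mpoly R[n]} -> R) d P :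
  deg2_le d P -> eq_on (deg_le d) L L' -> yapp L P = yapp L' P.
Proof.
move=> dP eqLL'; apply: eq_big_seq => m m_P; congr (_ *: _); apply: eqLL' => k.
rewrite msuppX inE => /eqP ->.
have P_m_neq0 : P@_m != 0 by rewrite -mcoeff_msupp.
have := dP _ _ (mlead_supp P_m_neq0).
by apply: le_trans; rewrite PoszD lerDl.
Qed.
End Degree.

(** * Functionals acting on one group of variables *)

Section Functionals.
Set Implicit Arguments.
Unset Strict Implicit.
Context {n : nat} {R : comNzRingType}.
Implicit Types (F G : {mpoly R[n]}) (P : {mpoly {mpoly R[n]}[n]}).
Implicit Types (L l : {scalar {mpoly R[n]}}).

(** The functional acts on [x] and [y] is renamed [x]: the mirror image of
    [yapp]. *)
Definition xapp (l : {mpoly R[n]} -> R) P : {mpoly R[n]} :=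
  \sum_(m <- msupp P) l P@_m *: 'X_[m].

Lemma aty_mpolyX (m : 'X_{1..n}) : aty ('X_[m] : {mpoly R[n]}) = 'X_[m].
Proof. by rewrite /aty map_mpolyX. Qed.

Lemma yapp_mpolyX L m : yapp L 'X_[m] = (L 'X_[m])%:MP.
Proof.
by rewrite /yapp msuppX big_seq1 mcoeffX eqxx /= -mul_mpolyC mulr1.
Qed.

Lemma yapp_aty L F : yapp L (aty F) = (L F)%:MP.
Proof.
have atyE : aty F = \sum_(m <- msupp F) (F@_m)%:MP *: 'X_[m].
  rewrite [F in LHS]mpolyE /aty rmorph_sum; apply: eq_bigr => m _ /=.
  by rewrite -mul_mpolyC rmorphM /= map_mpolyC map_mpolyX mul_mpolyC.
rewrite atyE linear_sum [F in RHS]mpolyE linear_sum rmorph_sum.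
apply: eq_bigr => m _ /=.
by rewrite !linearZ /= yapp_mpolyX rmorphM.
Qed.

Lemma yapp_mul_aty L G P : yapp L (aty G * P) = yapp (dotf L G) P.
Proof.
rewrite [P in LHS]mpolyE mulr_sumr raddf_sum; apply: eq_bigr => m _ /=.
rewrite -scalerAr linearZ /= -aty_mpolyX.
have -> : aty G * aty 'X_[m] = aty (G * 'X_[m]) by rewrite /aty rmorphM.
by rewrite yapp_aty mulrC mul_mpolyC.
Qed.

(** Both sides are the tensor product of [l], acting on [x], and [L], acting on
    [y], evaluated at [P]. *)
Lemma functional_yapp l L P : l (yapp L P) = L (xapp l P).
Proof.
rewrite /yapp /xapp !linear_sum; apply: eq_bigr => m _.
by rewrite !linearZ /= mulrC.
Qed.

End Functionals.

(** * The ideal and the bordered determinant *)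

Section Ideal.
Set Implicit Arguments.
Unset Strict Implicit.
Context {n : nat} {R : comNzRingType}.
Variable f : 'I_n -> {mpoly R[n]}.
Implicit Types (p q : {mpoly R[n]}).

Lemma in_idealD p q : in_ideal f p -> in_ideal f q -> in_ideal f (p + q).
Proof.
move=> [g ->] [h ->]; exists (fun i => g i + h i).
by rewrite -big_split; apply: eq_bigr => i _; rewrite mulrDl.
Qed.

Lemma in_idealM p q : in_ideal f q -> in_ideal f (p * q).
Proof.
move=> [g ->]; exists (fun i => p * g i).
by rewrite mulr_sumr; apply: eq_bigr => i _; rewrite mulrA.
Qed.

Lemma in_idealN p : in_ideal f p -> in_ideal f (- p).
Proof. by rewrite -mulN1r; apply: in_idealM. Qed.

Lemma in_idealB p q : in_ideal f p -> in_ideal f q -> in_ideal f (p - q).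
Proof. by move=> fp fq; apply: in_idealD => //; apply: in_idealN. Qed.

Lemma in_ideal_gen i p : in_ideal f (p * f i).
Proof.
apply: in_idealM; exists (fun j => (j == i)%:R).
rewrite (bigD1 i) //= eqxx mul1r big1 ?addr0 // => j /negPf ->.
by rewrite mul0r.
Qed.

Lemma annuls_eq (l : {scalar {mpoly R[n]}}) p q :
  annuls l (in_ideal f) -> in_ideal f (p - q) -> l p = l q.
Proof. by move=> l_f /l_f /eqP; rewrite linearB subr_eq0 => /eqP. Qed.

Lemma in_idealBC p q : in_ideal f (p - q) -> in_ideal f (q - p).
Proof. by move/in_idealN; rewrite opprB. Qed.

Lemma in_ideal_trans p q r :
  in_ideal f (p - q) -> in_ideal f (q - r) -> in_ideal f (p - r).
Proof. by move=> fpq /(in_idealD fpq); rewrite addrA subrK. Qed.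

(** The coefficients [c i] are cofactors of the last row; all that matters below
    is that they exist. *)
Lemma det_border_mod (S : comNzRingType) k (A : 'M[S]_k) (u : 'cV_k)
    (r : 'rV_k) (a : S) :
  exists c : 'I_k -> S,
    \det (block_mx A u r a%:M) = a * \det A + \sum_i c i * r 0 i.
Proof.
have det0 : exists c : 'I_k -> S,
    \det (block_mx A u r 0%:M) = \sum_i c i * r 0 i.
  exists (fun i => cofactor (block_mx A u r 0%:M) (rshift k ord0) (lshift 1 i)).
  rewrite (expand_det_row _ (rshift k ord0)) big_split_ord /= big_ord1.
  rewrite block_mxEdr mxE mul0rn mul0r addr0.
  by apply: eq_bigr => i _; rewrite block_mxEdl mulrC.
have [c det_c] := det0; exists c; rewrite -det_c.
have -> : block_mx A u r a%:M = block_mx A (a *: 0 + u) r (a * 1 + 0)%:M.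
  by rewrite scaler0 add0r mulr1 addr0.
by rewrite det_border det_lblock det1 mulr1.
Qed.

End Ideal.

(** * The extension operation *)

Section Extension.
Set Implicit Arguments.
Unset Strict Implicit.
Context {n : nat} {R : comNzRingType}.
Variable f : 'I_n -> {mpoly R[n]}.
Variable N : 'M[{mpoly {mpoly R[n]}[n]}]_n.
Hypothesis hN : forall i, diff_derivative (f i) (col i N).
Variable D : {linear {mpoly R[n]} -> 'cV[{mpoly {mpoly R[n]}[n]}]_n |
               (@mpolyC n {mpoly R[n]} \o @mpolyC n R) \; *:%R}.
Hypothesis hD : forall F, diff_derivative F (D F).
Implicit Types (F G : {mpoly R[n]}) (L l : {scalar {mpoly R[n]}}).

(** Column [j] of [N] has degree at most [deg (f j) - 1]. *)
Lemma deg2_le_det_diff : deg2_le (delta f) (\det N).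
Proof.
by apply: deg2_le_det => i j; have [/(_ i)] := hN j; rewrite mxE.
Qed.

(** Last row of the bordered determinant taken at [x]: its entries [f i] lie in
    the ideal, and [L] acting on [y] is linear over [R[x]]. *)
Lemma ext_mod_ideal L F : in_ideal f (ext f N D L F - F * yapp L (\det N)).
Proof.
have [c det_c] := det_border_mod N (D F) (\row_i atx (f i)) (atx F).
rewrite /ext /ext_det det_c linearD /= /atx mul_mpolyC linearZ /= addrAC subrr.
rewrite add0r linear_sum; elim/big_ind: _ => [||i _ /=].
- by exists (fun=> 0); rewrite big1 // => i _; rewrite mul0r.
- exact: in_idealD.
by rewrite mxE mulrC mul_mpolyC linearZ /= mulrC; apply: in_ideal_gen.
Qed.

(** Last row taken at [y]: the terms with a factor [f i] in the variables [y]
    are killed by [l] coefficient by coefficient in [x]. *)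
Lemma ext_annuls l F :
  annuls l (in_ideal f) -> ext f N D l F = yapp (dotf l F) (\det N).
Proof.
move=> l_f; rewrite /ext ext_det_aty //.
have [c ->] := det_border_mod N (D F) (\row_i aty (f i)) (aty F).
rewrite linearD linear_sum /= big1 ?addr0 ?yapp_mul_aty // => i _.
rewrite mxE mulrC yapp_mul_aty /yapp big1 // => m _.
by rewrite /dotf mulrC (l_f _ (in_ideal_gen _ _ _)) scale0r.
Qed.

Section Unit.
Variable E : {scalar {mpoly R[n]}}.
Hypothesis hE : annuls E (in_ideal f).
Hypothesis hE1 : in_ideal f (ext f N D E 1 - 1).
Notation ext := (ext f N D).
Notation extf := (extf f N D).

Lemma deg_le_ext F : deg_le (delta f) (ext E F).
Proof. by rewrite ext_annuls //; apply/deg_le_yapp/deg2_le_det_diff. Qed.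

Lemma ext_retract F : in_ideal f (F - ext E F).
Proof.
have det1 : in_ideal f (yapp E (\det N) - 1).
  apply: in_ideal_trans hE1; apply: in_idealBC.
  by have := ext_mod_ideal E 1; rewrite mul1r.
apply: in_idealBC; apply: in_ideal_trans (ext_mod_ideal E F) _.
by rewrite -[X in _ - X]mulr1 -mulrBr; apply: in_idealM.
Qed.

Lemma functional_ext l F : annuls l (in_ideal f) -> l (ext E F) = l F.
Proof. by move=> l_f; apply/esym/(annuls_eq l_f)/ext_retract. Qed.

(** Every [l] annulling the ideal has the form [E . w], and [w] is recovered
    modulo the ideal from [l] as [l(y).Delta]. *)
Lemma functional_eq_dotf l :
  annuls l (in_ideal f) -> l =1 dotf E (yapp l (\det N)).
Proof.
move=> l_f; pose w := xapp l (\det N).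
  (* Apply [l] on [x] and [E] on [y] to [F(y) Delta(x,y)] in both orders. *)
have lE : l =1 dotf E w.
  move=> F; rewrite -functional_ext // ext_annuls // functional_yapp.
  by rewrite /dotf mulrC.
have -> : yapp l (\det N) = ext E w.
  by rewrite ext_annuls //; apply: eq_bigr => m _; rewrite lE.
move=> F; rewrite lE /dotf; apply: (annuls_eq hE).
by rewrite -mulrBl mulrC; apply/in_idealM/ext_retract.
Qed.

Lemma extf_dotf L F : extf E L F = dotf E (yapp L (\det N)) F.
Proof. by rewrite /dotf mulrC; apply/(annuls_eq hE)/ext_mod_ideal. Qed.

(** Only the values of [L] in degree at most [delta f] enter: those of [L * E]
    are values of [L] at polynomials [E * F], and [E * L] depends on [L] through
    [L(y).Delta] alone. *)
Lemma extf_eq_on L l d :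
  0 <= d -> annuls l (in_ideal f) -> eq_on (deg_le (delta f + d)) L l ->
  l =1 extf E L /\ l =1 extf L E.
Proof.
move=> d_ge0 l_f eqLl.
have {}eqLl : eq_on (deg_le (delta f)) L l.
  by move=> p dp; apply: eqLl; apply: deg_le_trans dp; rewrite lerDl.
split=> F.
  rewrite extf_dotf (eq_yapp deg2_le_det_diff eqLl).
  exact: functional_eq_dotf.
by rewrite /extf eqLl ?functional_ext //; apply: deg_le_ext.
Qed.

Lemma deg_le_sub_ext d F :
  deg_le d F -> deg_le (Num.max (delta f) d) (F - ext E F).
Proof.
move=> dF; apply: deg_leD; last apply: deg_leN.
  by apply: deg_le_trans dF; rewrite le_max lexx orbT.
by apply: deg_le_trans (@deg_le_ext F); rewrite le_max lexx.
Qed.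

(** If [L] annuls the part of the ideal of degree at most [delta f + d], then
    [L * E] annuls the whole ideal: [E * F] lies in the ideal when [F] does,
    and its degree is always at most [delta f]. *)
Lemma extf_annuls_eq_on L d :
  0 <= d -> annuls L (fun p => in_ideal f p /\ deg_le (delta f + d) p) ->
  annuls (extf L E) (in_ideal f) /\
  eq_on (deg_le (delta f + d)) L (extf L E).
Proof.
move=> d_ge0 L_f; have le_d : delta f <= delta f + d by rewrite lerDl.
split=> F.
  move=> f_F; apply: L_f; split; last exact: deg_le_trans le_d (@deg_le_ext F).
  by rewrite -[ext E F](subKr F); apply/in_idealB/ext_retract.
move=> dF; apply/eqP; rewrite -subr_eq0 /extf -linearB; apply/eqP/L_f.
split; first exact: ext_retract.
by have := deg_le_sub_ext dF; rewrite (max_r le_d).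
Qed.

End Unit.
End Extension.

Theorem theorem6 (R : comNzRingType) (n : nat)
    (f : 'I_n -> {mpoly R[n]}) (f_neq0 : forall i, f i != 0)
    (N : 'M[{mpoly {mpoly R[n]}[n]}]_n)
    (hN : forall i, diff_derivative (f i) (col i N))
    (D : {linear {mpoly R[n]} -> 'cV[{mpoly {mpoly R[n]}[n]}]_n |
            (@mpolyC n {mpoly R[n]} \o @mpolyC n R) \; *:%R})
    (hD : forall F, diff_derivative F (D F))
    (E : {scalar {mpoly R[n]}})
    (hE : annuls E (in_ideal f))
    (hE1 : in_ideal f (ext f N D E 1 - 1)) :
  [/\ (* 1 *)
      forall (d : int) (F : {mpoly R[n]}), deg_le d F ->
        [/\ deg_le (delta f) (ext f N D E F),
            in_ideal f (F - ext f N D E F)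
          & deg_le (Num.max (delta f) d) (F - ext f N D E F)],
      (* 2 *)
      forall l : {scalar {mpoly R[n]}}, annuls l (in_ideal f) ->
        [/\ l =1 extf f N D E l,
            l =1 extf f N D l E
          & l =1 dotf E (yapp l (\det N))],
      (* 3 *)
      forall (l L' : {scalar {mpoly R[n]}}) (d : int), 0 <= d ->
        annuls l (in_ideal f) ->
        eq_on (deg_le (delta f + d)) L' l ->
        l =1 extf f N D E L' /\ l =1 extf f N D L' E,
      (* 4 *)
      forall (L : {scalar {mpoly R[n]}}) (d : int), 0 <= d ->
        annuls L (fun p => in_ideal f p /\ deg_le (delta f + d) p) ->
        [/\ eq_on (deg_le (delta f + d)) L (extf f N D E L),
            eq_on (deg_le (delta f + d)) L (extf f N D L E),
            extf f N D E L =1 extf f N D L E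
          & annuls (extf f N D E L) (in_ideal f)]
    & (* 5 *)
      forall (l l' : {scalar {mpoly R[n]}}) (d : int), 0 <= d ->
        annuls l (in_ideal f) -> annuls l' (in_ideal f) ->
        eq_on (deg_le (delta f + d)) l l' -> l =1 l'].
Proof.
split.
- move=> d F dF; split; first exact: deg_le_ext.
    exact: ext_retract.
  exact: deg_le_sub_ext.
- move=> l l_f.
  have [lEl llE] :=
    extf_eq_on hN hD hE hE1 (lexx 0) l_f (fun p _ => erefl (l p)).
  split; [exact: lEl | exact: llE |].
  exact: (functional_eq_dotf hN hD hE hE1 l_f).
- by move=> l L' d d_ge0 l_f; apply: (extf_eq_on hN hD hE hE1 d_ge0 l_f).
- move=> L d d_ge0 L_f.
  have [LE_f eqL] := extf_annuls_eq_on hN hD hE hE1 d_ge0 L_f.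
  have [LE_EL _] := extf_eq_on hN hD hE hE1 d_ge0 LE_f eqL.
  split=> [p dp||p|p f_p].
  + by rewrite -LE_EL; apply: eqL.
  + exact: eqL.
  + by rewrite -LE_EL.
  + by rewrite -LE_EL; apply: LE_f.
- move=> l l' d d_ge0 l_f l'_f eql F.
  rewrite -(functional_ext hE1 F l_f).
  rewrite -(functional_ext hE1 F l'_f); apply: eql.
  by apply: deg_le_trans (@deg_le_ext _ _ _ _ hN _ hD _ hE F); rewrite lerDl.
Qed.
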